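(* Let $(X,D,P)$ be a complete perturbed metric space with exact metric $d=D-P$. Let $T:X\to X$ and let $a,b,c,h,e\ge 0$ be such that for all $x,y\in X$ $$D(Tx,Ty)\le a\,D(x,y)+b\,D(x,Tx)+c\,D(y,Ty)+h\,D(x,Ty)+e\,D(y,Tx).$$ Let $a_0,b_0,c_0,h_0,e_0\ge 0$ be constants such that for all $x,y\in X$ $$a\,P(x,y)+b\,P(x,Tx)+c\,P(y,Ty)+h\,P(x,Ty)+e\,P(y,Tx)\le a_0\,d(x,y)+b_0\,d(x,Tx)+c_0\,d(y,Ty)+h_0\,d(x,Ty)+e_0\,d(y,Tx),$$ and suppose $(a+a_0)+(b+b_0)+(c+c_0)+(h+h_0)+(e+e_0)<1$. Let $x^\ast$ be the unique fixed point of $T$ (which exists under these hypotheses). If a sequence $(u_k)\subset X$ satisfies $D(u_k,Tu_k)\to 0$, then $u_k\to x^\ast$ in $(X,d)$.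
   Context: A perturbed metric space $(X,D,P)$ consists of a set $X$ and two functions $D,P:X\times X\to[0,\infty)$ such that $d(x,y):=D(x,y)-P(x,y)$ is a metric on $X$, called the exact metric. Neither $D$ nor $P$ is assumed symmetric. $(X,D,P)$ is called complete if the metric space $(X,d)$ is complete. *)

(* Defs.v *)
From mathcomp Require Import all_boot all_order all_algebra.
From mathcomp Require Import all_classical all_reals all_analysis.

Set Implicit Arguments.
Unset Strict Implicit.
Unset Printing Implicit Defensive.

Import Order.TTheory GRing.Theory Num.Theory.
Import numFieldNormedType.Exports.

Local Open Scope classical_set_scope.
Local Open Scope ring_scope.

(* The exact metric [D - P] is carried by the [metricType] structure of [X]:
   given [D] and [P] on a type, the condition "[D - P] is a metric" is exactly
   what the factory [isMetric] requires to equip that type with this structure,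
   so topological and uniform notions on [X] are those of the exact metric.
   Neither [D] nor [P] is required to be symmetric. *)
Definition perturbed_metric (R : realType) (X : metricType R)
    (D P : X -> X -> R) : Prop :=
  [/\ forall x y, 0 <= D x y,
      forall x y, 0 <= P x y
    & forall x y, mdist x y = D x y - P x y].

(* Sequential completeness; the library's [completeType] asks for convergence
   of all Cauchy filters. *)
Definition complete_metric (R : realType) (X : metricType R) : Prop :=
  forall u : nat -> X, cauchy (u @ \oo) -> exists l : X, u @ \oo --> l.

(* Main.v *)
(* Adding the bound on the perturbation terms to the contraction inequality for
   [D] shows that the exact metric [d] satisfies a Hardy-Rogers contraction with
   coefficients [a + a0], ..., which may be symmetrized by exchanging [x] and
   [y].  The key estimate is that such a contraction controls distances by
   displacements: [d x y] is at most a constant times [d x (T x) + d y (T y)].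
   Hence a sequence whose displacements tend to [0] is Cauchy, its limit is a
   fixed point, and every such sequence tends to the same point; Picard iterates
   provide one. *)
Require Import Defs.
From mathcomp Require Import all_boot all_order all_algebra.
From mathcomp Require Import all_classical all_reals all_analysis.
From mathcomp Require Import lra.

Import Order.TTheory GRing.Theory Num.Theory.
Import numFieldNormedType.Exports.
Import metricType_numDomainType.

Local Open Scope classical_set_scope.
Local Open Scope ring_scope.

Definition hardy_rogers {R : realType} {X : metricType R} (A s t : R)
    (T : X -> X) : Prop :=
  [/\ 0 <= A, 0 <= s, 0 <= t, A + 2 * s + 2 * t < 1
    & forall x y, mdist (T x) (T y) <= A * mdist x y
        + s * (mdist x (T x) + mdist y (T y))
        + t * (mdist x (T y) + mdist y (T x))].

(** Write [D] as the exact distance plus [P]: on the right the hypothesis absorbs the [P] terms, and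
    on the left [P (T x) (T y)] is dropped as nonnegative. *)
Lemma perturbed_hardy_rogers {R : realType} {X : metricType R}
    {D P : X -> X -> R} {T : X -> X} {a b c h e a0 b0 c0 h0 e0 : R} :
  perturbed_metric D P ->
  0 <= a -> 0 <= b -> 0 <= c -> 0 <= h -> 0 <= e ->
  (forall x y : X,
     D (T x) (T y) <= a * D x y + b * D x (T x) + c * D y (T y)
                      + h * D x (T y) + e * D y (T x)) ->
  0 <= a0 -> 0 <= b0 -> 0 <= c0 -> 0 <= h0 -> 0 <= e0 ->
  (forall x y : X,
     a * P x y + b * P x (T x) + c * P y (T y)
       + h * P x (T y) + e * P y (T x)
     <= a0 * mdist x y + b0 * mdist x (T x) + c0 * mdist y (T y)
        + h0 * mdist x (T y) + e0 * mdist y (T x)) ->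
  (a + a0) + (b + b0) + (c + c0) + (h + h0) + (e + e0) < 1 ->
  hardy_rogers (a + a0) ((b + b0 + c + c0) / 2) ((h + h0 + e + e0) / 2) T.
Proof.
move=> [_ P0 dE] age bge cge hge ege DT a0ge b0ge c0ge h0ge e0ge PT sum_lt1.
have DE x y : D x y = mdist x y + P x y by rewrite dE subrK.
have dT x y : mdist (T x) (T y) <=
    (a + a0) * mdist x y + (b + b0) * mdist x (T x) + (c + c0) * mdist y (T y)
    + (h + h0) * mdist x (T y) + (e + e0) * mdist y (T x).
  by move: (DT x y) (PT x y) (P0 (T x) (T y)); rewrite !DE; lra.
split; [lra..|] => x y.
(* Averaging the inequalities at [(x, y)] and [(y, x)] produces the halved coefficients. *)
have := dT y x; rewrite (metric_sym (T y)) (metric_sym y x).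
by move: (dT x y); lra.
Qed.

(** Follow the path [x], [T x], [T y], [y] and contract its middle leg. Cross distances cost one
    [mdist x y] plus a displacement, so the displacements end up with factor [1 + s + t], rounded up
    to 2. *)
Lemma hardy_rogers_dist {R : realType} {X : metricType R} {A s t : R}
    {T : X -> X} (x y : X) :
  hardy_rogers A s t T ->
  (1 - A - 2 * t) * mdist x y <= 2 * (mdist x (T x) + mdist y (T y)).
Proof.
move=> [A0 s0 t0 lt1 /(_ x y) dT].
have xy := metric_triangle x (T x) y.
have Txy := metric_triangle (T x) (T y) y.
have xTy : t * mdist x (T y) <= t * (mdist x y + mdist y (T y)).
  by rewrite ler_wpM2l// metric_triangle.
have yTx : t * mdist y (T x) <= t * (mdist x y + mdist x (T x)).
  by rewrite ler_wpM2l// (metric_sym x y) metric_triangle.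
have st1 : (s + t) * (mdist x (T x) + mdist y (T y))
    <= 1 * (mdist x (T x) + mdist y (T y)).
  by rewrite ler_wpM2r ?addr_ge0 ?mdist_ge0//; lra.
by move: dT xy Txy xTy yTx st1; rewrite (metric_sym (T y) y); lra.
Qed.

(** The contraction at [(x, T x)], where one cross term vanishes and the other splits at [T x]. *)
Lemma hardy_rogers_displacement {R : realType} {X : metricType R} {A s t : R}
    {T : X -> X} (x : X) :
  hardy_rogers A s t T ->
  mdist (T x) (T (T x)) <= (A + s + t) / (1 - s - t) * mdist x (T x).
Proof.
move=> [A0 s0 t0 lt1 /(_ x (T x)) dT].
have tTT : t * mdist x (T (T x)) <= t * (mdist x (T x) + mdist (T x) (T (T x))).
  by rewrite ler_wpM2l// metric_triangle.
rewrite mulrAC ler_pdivlMr; last lra.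
by move: dT tTT; rewrite mdistxx; lra.
Qed.

(** Substitute for continuity of [T] at a limit [z], obtained along the path [z], [x], [T x],
    [T z]. *)
Lemma hardy_rogers_displacement_near {R : realType} {X : metricType R}
    {A s t : R} {T : X -> X} (z x : X) :
  hardy_rogers A s t T ->
  (1 - s - t) * mdist z (T z) <= 2 * (mdist z x + mdist x (T x)).
Proof.
move=> [A0 s0 t0 lt1 /(_ x z) dT].
have zx := metric_triangle z x (T z).
have xTz := metric_triangle x (T x) (T z).
have txTz : t * mdist x (T z) <= t * (mdist z x + mdist z (T z)).
  by rewrite ler_wpM2l// (metric_sym z x) metric_triangle.
have tzTx : t * mdist z (T x) <= t * (mdist z x + mdist x (T x)).
  by rewrite ler_wpM2l// metric_triangle.
have At1 : (A + 2 * t) * mdist z x <= 1 * mdist z x.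
  by rewrite ler_wpM2r ?mdist_ge0//; lra.
have st1 : (s + t) * mdist x (T x) <= 1 * mdist x (T x).
  by rewrite ler_wpM2r ?mdist_ge0//; lra.
by move: dT zx xTz txTz tzTx At1 st1; rewrite (metric_sym x z); lra.
Qed.

Lemma hardy_rogers_cvg {R : realType} {X : metricType R} {A s t : R}
    {T : X -> X} {z : X} {u : nat -> X} :
  hardy_rogers A s t T -> T z = z ->
  mdist (u k) (T (u k)) @[k --> \oo] --> (0 : R) -> u k @[k --> \oo] --> z.
Proof.
move=> HR Tz u0; have [A0 s0 t0 lt1 _] := HR.
apply/cvgrPdist_lt => eps eps0.
(* As [z] has zero displacement, only the factor 2 of the key estimate must be offset. *)
have del0 : 0 < (1 - A - 2 * t) * eps / 2.
  by rewrite divr_gt0// mulr_gt0//; lra.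
near=> k.
have uk : `|mdist (u k) (T (u k))| < (1 - A - 2 * t) * eps / 2.
  by near: k; exact: (cvgr0_norm_lt _ u0).
have := hardy_rogers_dist z (u k) HR; rewrite Tz mdistxx add0r => zu.
rewrite -(@ltr_pM2l _ (1 - A - 2 * t)); last lra.
by move: uk zu; rewrite ger0_norm ?mdist_ge0//; lra.
Unshelve. all: by end_near. Qed.

Lemma hardy_rogers_cauchy {R : realType} {X : metricType R} {A s t : R}
    {T : X -> X} {u : nat -> X} :
  hardy_rogers A s t T ->
  mdist (u k) (T (u k)) @[k --> \oo] --> (0 : R) -> cauchy (u @ \oo).
Proof.
move=> HR u0; have [A0 s0 t0 lt1 _] := HR.
apply: cauchy_exP => eps eps0.
(* A quarter, since two displacements enter, each with factor 2. *)
have del0 : 0 < (1 - A - 2 * t) * eps / 4.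
  by rewrite divr_gt0// mulr_gt0//; lra.
have [N _ uN] := cvgr0_norm_lt _ u0 _ del0.
exists (u N); exists N => // n /= Nn; rewrite ballEmdist/=.
have := hardy_rogers_dist (u N) (u n) HR.
move: (uN N (leqnn N)) (uN n Nn) => /=.
rewrite !ger0_norm ?mdist_ge0// => pN pn duu.
by rewrite -(@ltr_pM2l _ (1 - A - 2 * t)); lra.
Qed.

Lemma hardy_rogers_lim_fixed {R : realType} {X : metricType R} {A s t : R}
    {T : X -> X} {z : X} {u : nat -> X} :
  hardy_rogers A s t T ->
  mdist (u k) (T (u k)) @[k --> \oo] --> (0 : R) -> u k @[k --> \oo] --> z ->
  T z = z.
Proof.
move=> HR u0 uz; have [A0 s0 t0 lt1 _] := HR.
apply/esym/mdist_positivity/eqP; rewrite eq_le mdist_ge0 andbT.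
apply/ler_addgt0Pl => eps eps0; rewrite addr0.
have del0 : 0 < (1 - s - t) * eps / 4.
  by rewrite divr_gt0// mulr_gt0//; lra.
near \oo => k.
have uk : `|mdist (u k) (T (u k))| < (1 - s - t) * eps / 4.
  by near: k; exact: (cvgr0_norm_lt _ u0).
have zu : mdist z (u k) < (1 - s - t) * eps / 4.
  by near: k; exact: (cvgr_dist_lt uz).
rewrite -(@ler_pM2l _ (1 - s - t)); last lra.
move: uk zu (hardy_rogers_displacement_near z (u k) HR).
by rewrite ger0_norm ?mdist_ge0//; lra.
Unshelve. all: by end_near. Qed.

Lemma hardy_rogers_picard {R : realType} {X : metricType R} {A s t : R}
    {T : X -> X} (x : X) :
  hardy_rogers A s t T ->
  mdist (iter k T x) (T (iter k T x)) @[k --> \oo] --> (0 : R).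
Proof.
move=> HR; have [A0 s0 t0 lt1 _] := HR.
set q := (A + s + t) / (1 - s - t).
have q0 : 0 <= q by rewrite divr_ge0//; lra.
(* [q < 1] is exactly [A + 2 * s + 2 * t < 1]. *)
have q1 : `|q| < 1 by rewrite ger0_norm// ltr_pdivrMr; lra.
have le_geo k : mdist (iter k T x) (T (iter k T x)) <=
    geometric (mdist x (T x)) q k.
  elim: k => [|k IH]; first by rewrite /= expr0 mulr1.
  rewrite iterS (le_trans (hardy_rogers_displacement _ HR))//.
  by rewrite /= exprS mulrCA ler_wpM2l.
apply: (squeeze_cvgr _ (cvg_cst 0) (cvg_geometric (mdist x (T x)) q1)).
by apply: nearW => k; rewrite mdist_ge0 le_geo.
Qed.

Theorem corollary3p19 (R : realType) (X : metricType R) (D P : X -> X -> R)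
    (T : X -> X) (a b c h e a0 b0 c0 h0 e0 : R) :
  [set: X] !=set0 ->
  perturbed_metric D P ->
  complete_metric X ->
  0 <= a -> 0 <= b -> 0 <= c -> 0 <= h -> 0 <= e ->
  (forall x y : X,
     D (T x) (T y) <= a * D x y + b * D x (T x) + c * D y (T y)
                      + h * D x (T y) + e * D y (T x)) ->
  0 <= a0 -> 0 <= b0 -> 0 <= c0 -> 0 <= h0 -> 0 <= e0 ->
  (forall x y : X,
     a * P x y + b * P x (T x) + c * P y (T y)
       + h * P x (T y) + e * P y (T x)
     <= a0 * mdist x y + b0 * mdist x (T x) + c0 * mdist y (T y)
        + h0 * mdist x (T y) + e0 * mdist y (T x)) ->
  (a + a0) + (b + b0) + (c + c0) + (h + h0) + (e + e0) < 1 ->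
  exists xs : X,
    [/\ T xs = xs,
        forall x : X, T x = x -> x = xs
      & forall u : nat -> X,
          D (u k) (T (u k)) @[k --> \oo] --> (0 : R) ->
          u k @[k --> \oo] --> xs].
Proof.
move=> [x0 _] DP Xc a_ge0 b_ge0 c_ge0 h_ge0 e_ge0 DT.
move=> a0_ge0 b0_ge0 c0_ge0 h0_ge0 e0_ge0 PT sum_lt1.
have HR : hardy_rogers (a + a0) ((b + b0 + c + c0) / 2)
    ((h + h0 + e + e0) / 2) T by exact: (perturbed_hardy_rogers DP).
have x0_disp := hardy_rogers_picard x0 HR.
have [z x0z] := Xc _ (hardy_rogers_cauchy HR x0_disp).
have Tz := hardy_rogers_lim_fixed HR x0_disp x0z.
exists z; split => // [x Tx|u Du0].
  apply: mdist_positivity; apply/eqP; rewrite eq_le mdist_ge0 andbT.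
  (* Two fixed points have zero displacement, so the key estimate forces their distance to be 0. *)
  have := hardy_rogers_dist x z HR; rewrite Tx Tz !mdistxx addr0 mulr0.
  by rewrite pmulr_rle0//; lra.
apply: (hardy_rogers_cvg HR Tz).
(* Since [P] is nonnegative, exact displacements lie between 0 and those measured by [D]. *)
apply: (squeeze_cvgr _ (cvg_cst 0) Du0); apply: nearW => k.
have [_ P_ge0 dE] := DP.
by rewrite mdist_ge0 dE gerBl P_ge0.
Qed.
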